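(* Let $1 \leq p < \infty$, let $X$ be a Banach space and let $A \subset X$ be a $p$-limited set. Then $T(A)$ is relatively compact in $\ell_p$ for every bounded linear operator $T: X \to \ell_p$.
   Context: $X'$ denotes the topological dual of $X$. A sequence $(x_n') \subset X'$ is weak* $p$-summable if $\sum_n |x_n'(x)|^p < \infty$ for every $x \in X$. A subset $A \subset X$ is $p$-limited ($1 \leq p < \infty$) if for every weak* $p$-summable sequence $(x_n') \subset X'$ there is $a = (a_n) \in \ell_p$ such that $|x_n'(x)| < a_n$ for all $x \in A$ and all $n \in \mathbb{N}$. *)

(* Defs.v *)
From HB Require Import structures.
From mathcomp Require Import all_boot all_order all_algebra complex.
From mathcomp Require Import all_classical all_reals all_analysis.
Set Implicit Arguments.
Unset Strict Implicit.
Unset Printing Implicit Defensive.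
Import Order.TTheory GRing.Theory Num.Theory.
Import numFieldNormedType.Exports.

Local Open Scope classical_set_scope.
Local Open Scope ring_scope.

Inductive scalar_kind := RealScalars | ComplexScalars.

Definition scalars (R : realType) (s : scalar_kind) : numFieldType :=
  match s with RealScalars => R | ComplexScalars => R[i] end.

(* In MathComp the norm of a K-module takes its values in K itself, so for
   K = R[i] we need the real-valued modulus and the embedding of R in K. *)
Definition modulus (R : realType) (s : scalar_kind) : scalars R s -> R :=
  match s with
  | RealScalars => fun x : R => `|x|
  | ComplexScalars => fun z : R[i] => complex.Re `|z|
  end.

Definition ofR (R : realType) (s : scalar_kind) : R -> scalars R s :=
  match s with
  | RealScalars => fun x => x
  | ComplexScalars => fun x => (x%:C)%C
  end.
Arguments ofR {R} s _.

Section scalars_lemmas.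
Context (R : realType) (s : scalar_kind).
Implicit Types x y : scalars R s.

Lemma ofR_modulus x : ofR s (modulus x) = `|x|.
Proof. by case: s x => //= -[a b]; rewrite normc_def. Qed.

Lemma ofRD : {morph @ofR R s : a b / a + b}.
Proof. by case: s => // a b; rewrite /= rmorphD. Qed.

Lemma ofRM : {morph @ofR R s : a b / a * b}.
Proof. by case: s => // a b; rewrite /= rmorphM. Qed.

Lemma ofR0 : ofR s 0 = 0 :> scalars R s.
Proof. by case: s. Qed.

Lemma ler_ofR : {mono @ofR R s : a b / a <= b}.
Proof. by case: s => // a b; rewrite /= lecR. Qed.

Lemma ofR_inj : injective (@ofR R s).
Proof. by move=> a b ab; apply/eqP; rewrite eq_le -!ler_ofR ab lexx. Qed.

Lemma modulus_ge0 x : 0 <= modulus x.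
Proof. by rewrite -ler_ofR ofR_modulus ofR0. Qed.

Lemma modulusM x y : modulus (x * y) = modulus x * modulus y.
Proof. by apply: ofR_inj; rewrite ofRM !ofR_modulus normrM. Qed.

Lemma modulus_le x y : modulus (x + y) <= modulus x + modulus y.
Proof. by rewrite -ler_ofR ofRD !ofR_modulus ler_normD. Qed.

Lemma modulus0 : modulus (0 : scalars R s) = 0.
Proof. by apply: ofR_inj; rewrite ofR_modulus normr0 ofR0. Qed.

Lemma modulus_eq0 x : modulus x = 0 -> x = 0.
Proof. by move=> x0; apply/normr0_eq0; rewrite -ofR_modulus x0 ofR0. Qed.

End scalars_lemmas.

Definition p_summable (R : realType) (p : R) (u : nat -> R) : Prop :=
  (\sum_(n <oo) (`|u n| `^ p)%:E < +oo)%E.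

Definition p_norm (R : realType) (p : R) (u : nat -> R) : R :=
  fine (\sum_(n <oo) (`|u n| `^ p)%:E)%E `^ p^-1.

Section p_norm_lemmas.
Context (R : realType) (p : R) (p1 : 1 <= p).
Implicit Types u v : nat -> R.

Let p0 : 0 < p. Proof. exact: lt_le_trans p1. Qed.

Let sum_ge0 u : (0 <= \sum_(n <oo) (`|u n| `^ p)%:E)%E.
Proof. by apply: nneseries_ge0 => n _ _; rewrite lee_fin powR_ge0. Qed.

Let measurable_nat u : measurable_fun [set: nat] u.
Proof. by []. Qed.

Lemma p_normE u : p_summable p u ->
  (p_norm p u)%:E = Lnorm counting p%:E (EFin \o u).
Proof.
by move=> up; rewrite Lnorm_counting// /p_norm -poweR_EFin fineK ?ge0_fin_numE.
Qed.

Lemma p_summableE u :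
  p_summable p u <-> (Lnorm counting p%:E (EFin \o u) < +oo)%E.
Proof.
rewrite Lnorm_counting//; split=> [up|]; first exact: poweR_lty.
by move=> /lty_poweRy; apply; rewrite invr_neq0// gt_eqF.
Qed.

Lemma p_summable_le u v : (forall n, `|u n| <= `|v n|) ->
  p_summable p v -> p_summable p u.
Proof.
move=> uv; apply: le_lt_trans; apply: lee_nneseries => n _.
  by rewrite lee_fin powR_ge0.
by rewrite lee_fin ge0_ler_powR// ?nnegrE// ltW.
Qed.

Lemma p_norm_le u v : (forall n, `|u n| <= `|v n|) ->
  p_summable p v -> p_norm p u <= p_norm p v.
Proof.
move=> uv vp; have up := p_summable_le uv vp.
apply: ge0_ler_powR; rewrite ?nnegrE ?fine_ge0 ?invr_ge0// ?(ltW p0)//.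
apply: fine_le; rewrite ?ge0_fin_numE//.
apply: lee_nneseries => n _; first by rewrite lee_fin powR_ge0.
by rewrite lee_fin ge0_ler_powR// ?nnegrE// ltW.
Qed.

Lemma p_summableD u v : p_summable p u -> p_summable p v ->
  p_summable p (u \+ v).
Proof.
move=> /p_summableE up /p_summableE vp; apply/p_summableE.
have := @minkowski_EFin _ _ _ counting u v p
  (measurable_nat u) (measurable_nat v) p1.
by move=> /le_lt_trans; apply; rewrite lte_add_pinfty.
Qed.

Lemma p_normD u v : p_summable p u -> p_summable p v ->
  p_norm p (u \+ v) <= p_norm p u + p_norm p v.
Proof.
move=> up vp.
have := minkowski_EFin counting (measurable_nat u) (measurable_nat v) p1.
have <- := p_normE up; have <- := p_normE vp.
by have <- := p_normE (p_summableD up vp); rewrite -EFinD lee_fin.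
Qed.

Let sumZ (c : R) u : (\sum_(n <oo) (`|c * u n| `^ p)%:E =
  (`|c| `^ p)%:E * \sum_(n <oo) (`|u n| `^ p)%:E)%E.
Proof.
rewrite -nneseriesZl//.
by apply: eq_eseriesr => n _; rewrite normrM powRM.
Qed.

Lemma p_summableZ (c : R) u : p_summable p u ->
  p_summable p (fun n => c * u n).
Proof.
by move=> up; rewrite /p_summable sumZ lte_mul_pinfty// lee_fin powR_ge0.
Qed.

Lemma p_normZ (c : R) u : p_summable p u ->
  p_norm p (fun n => c * u n) = `|c| * p_norm p u.
Proof.
move=> up; rewrite /p_norm sumZ fineM ?ge0_fin_numE ?lee_fin ?powR_ge0 ?ltry//=.
by rewrite powRM ?powR_ge0 ?fine_ge0// -powRrM mulfV ?gt_eqF// powRr1.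
Qed.

Lemma p_summable0 : p_summable p (fun=> 0).
Proof.
rewrite /p_summable eseries0 ?ltry// => n _ _.
by rewrite normr0 powR0// gt_eqF.
Qed.

Lemma p_norm_eq0 u : p_summable p u -> p_norm p u = 0 -> forall n, u n = 0.
Proof.
move=> up /eqP; rewrite powR_eq0 => /andP[/eqP u0 _] n.
have sum0 : (\sum_(n <oo) (`|u n| `^ p)%:E = 0)%E.
  by rewrite -[LHS]fineK ?u0// ge0_fin_numE.
have : ((`|u n| `^ p)%:E <= 0)%E.
  rewrite -sum0; apply: le_trans (nneseries_lim_ge n.+1 _).
    rewrite big_nat_recr//= leeDr// sume_ge0// => k _.
  by move=> k _ _; rewrite lee_fin powR_ge0.
rewrite lee_fin => un0; apply: normr0_eq0.
have /eqP : `|u n| `^ p = 0 by apply/eqP; rewrite eq_le un0 powR_ge0.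
by rewrite powR_eq0 => /andP[/eqP].
Qed.

End p_norm_lemmas.

Definition ell_p_set (R : realType) (s : scalar_kind) (p : R) :
    {pred nat -> (scalars R s)^o} :=
  mem [set u | p_summable p (fun n => modulus (u n))].
Arguments ell_p_set {R} s p.

Section ell_p.
Context (R : realType) (s : scalar_kind) (p : R).
Local Notation K := (scalars R s).

Record ell_p (p1 : 1 <= p) := EllP {
  ell_p_seq :> nat -> K^o;
  ell_pP : ell_p_seq \in ell_p_set s p }.

Variable p1 : 1 <= p.

HB.instance Definition _ := [isSub for @ell_p_seq p1].
HB.instance Definition _ := [Choice of ell_p p1 by <:].

Lemma ell_p_summable (u : ell_p p1) : p_summable p (fun n => modulus (u n)).
Proof. by case: u => u /= /set_mem. Qed.

Lemma ell_p_submod_closed : submod_closed (ell_p_set s p).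
Proof.
split=> [|c u v /set_mem up /set_mem vp]; apply/mem_set => /=.
  rewrite [X in p_summable _ X](_ : _ = fun=> 0); first exact: p_summable0.
  by apply/funext => n; rewrite modulus0.
apply: (@p_summable_le _ _ p1 _
    ((fun n => modulus c * modulus (u n)) \+ (fun n => modulus (v n)))).
  move=> n; rewrite ger0_norm ?modulus_ge0// ger0_norm; last first.
    by rewrite addr_ge0 ?mulr_ge0 ?modulus_ge0.
  by rewrite (le_trans (modulus_le _ _))// lerD2r modulusM.
by apply: p_summableD => //; exact: p_summableZ.
Qed.

HB.instance Definition _ := GRing.isSubmodClosed.Build K (nat -> K^o)
  (ell_p_set s p) ell_p_submod_closed.
HB.instance Definition _ := [SubChoice_isSubLmodule of ell_p p1 by <:].

Definition ell_p_norm (u : ell_p p1) : K :=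
  ofR s (p_norm p (fun n => modulus (u n))).

Lemma ell_p_normD (u v : ell_p p1) :
  ell_p_norm (u + v) <= ell_p_norm u + ell_p_norm v.
Proof.
have up := ell_p_summable u; have vp := ell_p_summable v.
rewrite -ofRD ler_ofR; apply: le_trans (p_normD p1 up vp).
apply: p_norm_le => //; last exact: p_summableD.
move=> n /=; rewrite !ger0_norm ?addr_ge0 ?modulus_ge0//.
exact: modulus_le.
Qed.

Lemma ell_p_normZ (c : K) (u : ell_p p1) :
  ell_p_norm (c *: u) = `|c| * ell_p_norm u.
Proof.
rewrite -ofR_modulus -ofRM; congr ofR.
have := p_normZ p1 (modulus c) (ell_p_summable u).
rewrite (ger0_norm (modulus_ge0 c)) => pZ; rewrite /ell_p_norm; move: pZ => <-.
congr p_norm; apply/funext => n.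
exact: modulusM.
Qed.

Lemma ell_p_norm_eq0 (u : ell_p p1) : ell_p_norm u = 0 -> u = 0.
Proof.
rewrite /ell_p_norm -[RHS](ofR0 R s) => /ofR_inj u0.
apply/val_inj/funext => n; apply: modulus_eq0.
exact: (p_norm_eq0 (ell_p_summable u) u0).
Qed.

HB.instance Definition _ := Lmodule_isNormed.Build K (ell_p p1)
  ell_p_normD ell_p_normZ ell_p_norm_eq0.

End ell_p.

Definition weak_star_p_summable (R : realType) (s : scalar_kind) (p : R)
    (X : normedModType (scalars R s))
    (f : nat -> {linear X -> (scalars R s)^o}) : Prop :=
  forall x : X, (\sum_(n <oo) (modulus (f n x) `^ p)%:E < +oo)%E.

Definition p_limited (R : realType) (s : scalar_kind) (p : R)
    (X : normedModType (scalars R s)) (A : set X) : Prop :=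
  forall f : nat -> {linear X -> (scalars R s)^o},
    (forall n, continuous (f n)) -> weak_star_p_summable p f ->
    exists2 a : nat -> R, p_summable p a &
      forall x, A x -> forall n, modulus (f n x) < a n.

(* Main.v *)
Require Import Defs.
From HB Require Import structures.
From mathcomp Require Import all_boot all_order all_algebra complex lra.
From mathcomp Require Import all_classical all_reals all_analysis.
Set Implicit Arguments.
Unset Strict Implicit.
Unset Printing Implicit Defensive.
Import Order.TTheory GRing.Theory Num.Theory.
Import numFieldNormedType.Exports.

Local Open Scope classical_set_scope.
Local Open Scope ring_scope.

(** The coordinate functionals [x |-> (T x)_n] of an operator [T] into [ell_p]
    form a weak* p-summable sequence, because each [T x] lies in [ell_p].
    As [A] is p-limited, they are dominated on [A] by one [a] in [ell_p], so
    [T(A)] lies in the box of all [u] in [ell_p] with [|u_n| <= a_n].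

    It remains to see that such a box is compact ([compact_ell_p_box]); then
    [closure (T(A))] is a closed subset of a compact set.  As a set of
    sequences the box is a product of closed discs of scalars, which is compact
    for the topology of coordinatewise convergence by Tychonoff's theorem
    ([compact_seq_box]).  On the box this topology is as fine as that of the
    [ell_p] norm ([to_ell_p_continuous]): the tails of all differences of
    elements are dominated by the tails of [2 a], which are uniformly small, so
    closeness of finitely many coordinates suffices
    ([p_norm_dominated_small]). *)

Section scalar_topology.
Context (R : realType) (s : scalar_kind).
Local Notation K := (scalars R s).

Lemma ltr_ofR : {mono @ofR R s : a b / a < b}.
Proof. exact: leW_mono (@ler_ofR R s). Qed.

Lemma ofR_real (a : R) : ofR s a \is Num.real.
Proof. by rewrite realE -{1 2}(ofR0 R s) !ler_ofR -realE num_real. Qed.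

Lemma modulusN (x : K) : modulus (- x) = modulus x.
Proof. by apply: (@ofR_inj R s); rewrite !ofR_modulus normrN. Qed.

(** A positive scalar is its own norm, so radii may be taken in [R] even when
    the order that defines the topology lives in [R[i]]. *)
Lemma ofR_pos (e : K) : 0 < e -> exists2 d : R, 0 < d & ofR s d = e.
Proof.
move=> e0; have eE : ofR s (modulus e) = e by rewrite ofR_modulus gtr0_norm.
by exists (modulus e) => //; rewrite -ltr_ofR ofR0 eE.
Qed.

Lemma cvg_ofRP (V : normedModType K) (T : Type) (F : set_system T)
    {FF : Filter F} (f : T -> V) (y : V) :
  f @ F --> y <->
  forall e : R, 0 < e -> \forall t \near F, `|y - f t| < ofR s e.
Proof.
split=> [/cvgrPdist_lt h e e0|h].
  by apply: h; rewrite -(ofR0 R s) ltr_ofR.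
by apply/cvgrPdist_lt => e /ofR_pos[d d0 <-]; exact: h.
Qed.

Lemma modulus_continuous : continuous (@modulus R s : K^o -> R).
Proof.
move=> x.
apply/(@cvgrPdist_lt R R^o K (nbhs (x : K^o)) (nbhs_filter (x : K^o))) => e e0.
have : nbhs (x : K^o) [set y : K^o | `|x - y| < ofR s e].
  have /cvg_ofRP : (id : K^o -> K^o) @ x --> x by exact: cvg_id.
  exact.
(* The norms of K^o and of K agree only up to conversion. *)
apply: filterS => y.
rewrite /= -[`|x - y|]/(`|(x - y : K)|) -ofR_modulus ltr_ofR.
apply: le_lt_trans.
have xy : modulus x <= modulus (x - y) + modulus y.
  by rewrite -[X in modulus X <= _](subrK y) modulus_le.
have yx : modulus y <= modulus (x - y) + modulus x.
  rewrite -[modulus (x - y)]modulusN opprB.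
  by rewrite -[X in modulus X <= _](subrK x) modulus_le.
by rewrite ler_norml; apply/andP; split; lra.
Qed.

Lemma closed_modulus_disc (r : R) : closed [set z : K^o | modulus z <= r].
Proof.
have -> : [set z : K^o | modulus z <= r] =
    @modulus R s @^-1` [set x | x <= r] by [].
by apply: closed_comp => [x _|]; [exact: modulus_continuous|exact: closed_le].
Qed.

End scalar_topology.

Lemma complex_pair_continuous (R : realType) :
  continuous ((fun z => (z.1 +i* z.2)%C) : (R * R)%type -> R[i]^o).
Proof.
move=> [a b].
apply/(@cvg_ofRP R ComplexScalars R[i]^o _ _ _) => e e0.
have e20 : 0 < e / 2 by rewrite divr_gt0.
have ha : \forall z \near nbhs (a, b), `|a - z.1| < e / 2.
  apply: (@cvgr_dist_lt _ _ _ (nbhs (a, b)) _ (@fst R R)) => //.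
  exact: cvg_fst.
have hb : \forall z \near nbhs (a, b), `|b - z.2| < e / 2.
  apply: (@cvgr_dist_lt _ _ _ (nbhs (a, b)) _ (@snd R R)) => //.
  exact: cvg_snd.
near=> z => /=.
rewrite normc_def /= ltcR.
have az : `|a - z.1| < e / 2 by near: z.
have bz : `|b - z.2| < e / 2 by near: z.
apply: (@le_lt_trans _ _ (`|a - z.1| + `|b - z.2|)); last first.
  by rewrite [ltRHS]splitr ltrD.
rewrite -[leRHS]ger0_norm ?addr_ge0// -sqrtr_sqr ler_sqrt ?sqr_ge0//.
rewrite -(real_normK (num_real (a - z.1))) -(real_normK (num_real (b - z.2))).
by rewrite sqrrD lerD2r lerDl mulrn_wge0// mulr_ge0.
Unshelve. all: by end_near. Qed.

(** Heine-Borel for the scalar field: over the reals the disc is a segment, over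
    the complex numbers it is a closed part of the image of a compact square. *)
Lemma compact_modulus_disc (R : realType) (s : scalar_kind) (r : R) :
  compact [set z : (scalars R s)^o | modulus z <= r].
Proof.
case: s.
  have := @segment_compact R (- r) r.
  by congr compact; apply/seteqP; split => z /=; rewrite in_itv/= -ler_norml.
have sq : compact ((fun z : R * R => (z.1 +i* z.2)%C : R[i]^o) @`
    (`[- r, r] `*` `[- r, r])).
  apply: continuous_compact.
    by apply: continuous_subspaceT; exact: complex_pair_continuous.
  by apply: compact_setX; exact: segment_compact.
apply: (subclosed_compact _ sq).
  exact: (@closed_modulus_disc R ComplexScalars r).
move=> [a b] abr.
have {}abr : Num.sqrt (a ^+ 2 + b ^+ 2) <= r by exact: abr.
exists (a, b) => //=.
split; rewrite /= in_itv /= -ler_norml -sqrtr_sqr; apply: le_trans abr;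
  by rewrite ler_sqrt ?addr_ge0 ?sqr_ge0// ?lerDl ?lerDr sqr_ge0.
Qed.

(** Dominated convergence in quantitative form.  Choose [N] so that the tail of
    [\sum_n |b n|^p] beyond [N] is below [e^p / 2]; the first [N] terms of the
    sum for [w] add up to at most [e^p / 2] once [d^p <= e^p / (2 (N + 1))].
    Neither [N] nor [d] depends on [w]. *)
Lemma p_norm_dominated_small (R : realType) (p : R) (p1 : 1 <= p)
    (b : nat -> R) (e : R) : p_summable p b -> 0 < e ->
  exists N, exists2 d : R, 0 < d & forall w : nat -> R,
    (forall n, `|w n| <= `|b n|) -> (forall n, (n < N)%N -> `|w n| <= d) ->
    p_norm p w < e.
Proof.
move=> bp e0; have p0 : 0 < p by exact: (lt_le_trans ltr01 p1).
pose eta : R := e `^ p / 2.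
have eta0 : 0 < eta by rewrite divr_gt0// powR_gt0.
have pow_ge0 (u : nat -> R) n : (0 <= (`|u n| `^ p)%:E)%E.
  by rewrite lee_fin powR_ge0.
have [N tailN] : exists N, (\sum_(N <= k <oo) (`|b k| `^ p)%:E < eta%:E)%E.
  have tail0 := nneseries_tail_cvg bp (fun k _ => pow_ge0 b k).
  have : \forall N \near \oo,
      (\sum_(N <= k <oo) (`|b k| `^ p)%:E < eta%:E)%E.
    apply: (tail0 [set x | (x < eta%:E)%E]); apply: open_nbhs_nbhs.
    by split => //=; exact: open_ereal_lt_ereal.
  by move=> /filter_ex.
have etaN0 : 0 < eta / N.+1%:R by rewrite divr_gt0.
have rootK q : 0 <= q -> (q `^ p^-1) `^ p = q.
  by move=> q0; rewrite -powRrM mulVf ?gt_eqF// powRr1.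
exists N, ((eta / N.+1%:R) `^ p^-1); first by rewrite powR_gt0.
move=> w wb wd; rewrite /p_norm.
set S := (\sum_(n <oo) _)%E.
have S0 : (0 <= S)%E by exact: nneseries_ge0.
have SE : (S < (e `^ p)%:E)%E.
  rewrite /S (nneseries_split 0 N)// add0n sumEFin.
  rewrite [e `^ p]splitr EFinD lee_ltD//.
  - rewrite lee_fin.
    apply: (@le_trans _ _ (\sum_(0 <= k < N) eta / N.+1%:R)).
      apply: ler_sum_nat => k /andP[_ kN].
      rewrite -[leRHS](rootK _ (ltW etaN0)).
      apply: ge0_ler_powR; rewrite ?nnegrE ?powR_ge0 ?(ltW p0)//.
      exact: wd.
    rewrite sumr_const_nat subn0 -/eta.
    rewrite -[leLHS]mulr_natr mulrAC ler_pdivrMr//.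
    by rewrite ler_pM2l// ler_nat.
  - apply: le_lt_trans tailN; apply: lee_nneseries => k _ //.
    by rewrite lee_fin ge0_ler_powR// ?nnegrE// ltW.
have Sfin : S \is a fin_num by rewrite ge0_fin_numE// (lt_trans SE) ?ltry.
rewrite -[ltRHS]powRr1 ?(ltW e0)//.
rewrite -[X in _ < _ `^ X](mulfV (lt0r_neq0 p0)) powRrM.
rewrite gt0_ltr_powR ?invr_gt0 ?nnegrE ?fine_ge0 ?powR_ge0//.
by rewrite -lte_fin fineK.
Qed.

Section ell_p_topology.
Context (R : realType) (s : scalar_kind) (p : R) (p1 : 1 <= p).
Local Notation K := (scalars R s).

Lemma ell_p_normE (u : ell_p s p1) :
  `|u| = ofR s (p_norm p (fun n => modulus (u n))).
Proof. by []. Qed.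

Lemma ell_p_coord_le_norm (u : ell_p s p1) n : `|u n : K| <= `|u|.
Proof.
have p0 : 0 < p by exact: (lt_le_trans ltr01 p1).
rewrite ell_p_normE -ofR_modulus ler_ofR /p_norm.
set S := (\sum_(k <oo) _)%E.
have S0 : (0 <= S)%E.
  by apply: nneseries_ge0 => k _ _; rewrite lee_fin powR_ge0.
have Sfin : S \is a fin_num.
  by rewrite ge0_fin_numE//; exact: ell_p_summable.
rewrite -[leLHS]powRr1 ?modulus_ge0//.
rewrite -[X in _ `^ X <= _](mulfV (lt0r_neq0 p0)) powRrM.
apply: ge0_ler_powR;
  rewrite ?nnegrE ?invr_ge0 ?powR_ge0 ?fine_ge0 ?(ltW p0)//.
rewrite -lee_fin fineK//; apply: le_trans (nneseries_lim_ge n.+1 _).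
  rewrite big_nat_recr//= ger0_norm ?modulus_ge0//.
  by rewrite leeDr// sume_ge0// => k _; rewrite lee_fin powR_ge0.
by move=> k _ _; rewrite lee_fin powR_ge0.
Qed.

Context (a : nat -> R) (ap : p_summable p a).

Definition ell_p_box : set (ell_p s p1) :=
  [set u | forall n, modulus (u n) <= a n].

Definition seq_box : set (prod_topology (fun _ : nat => K^o)) :=
  [set u | forall n, modulus (u n) <= a n].

(** Sends sequences outside [ell_p] to [0]; it is only ever used on
    [seq_box]. *)
Definition to_ell_p (u : prod_topology (fun _ : nat => K^o)) : ell_p s p1 :=
  insubd 0 u.

Lemma to_ell_pE u : seq_box u -> to_ell_p u = u :> (nat -> K^o).
Proof.
move=> ua; rewrite /to_ell_p val_insubd ifT//.
apply/mem_set; apply: p_summable_le ap => // n /=.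
by rewrite !ger0_norm ?modulus_ge0 ?(le_trans (modulus_ge0 _) (ua n)).
Qed.

Lemma compact_seq_box : compact seq_box.
Proof.
apply: (@tychonoff _ (fun=> K^o) (fun n => [set z | modulus z <= a n])) => n.
exact: compact_modulus_disc.
Qed.

(** Two elements of the box differ coordinatewise by at most [2 a], so
    [p_norm_dominated_small] reduces closeness in norm to closeness of finitely
    many coordinates, which is a neighbourhood in the product. *)
Lemma to_ell_p_continuous : {within seq_box, continuous to_ell_p}.
Proof.
apply/subspace_continuousP => u ua; apply/cvg_ofRP => e e0.
have bp := p_summableZ 2 ap.
have [N [d d0 small]] := p_norm_dominated_small p1 bp e0.
have coord (n : 'I_N) : nbhs u [set v : nat -> K^o | modulus (u n - v n) < d].
  have un := @proj_continuous nat (fun=> K^o) n u.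
  have := (@cvg_ofRP R s K^o _ (nbhs u) (nbhs_filter u)
    (fun v => v n) (u n)).1 un d d0.
  apply: filterS => v.
  by rewrite /= -[`|_|]/(`|(u n - v n : K)|) -ofR_modulus ltr_ofR.
rewrite near_withinE.
have := @filter_forall _ _ _ _ (nbhs_filter u) coord.
apply: filterS => v uv va; rewrite /=.
have subE n : (to_ell_p u - to_ell_p v : ell_p s p1) n = u n - v n.
  by rewrite -[LHS]/(to_ell_p u n - to_ell_p v n) !to_ell_pE.
rewrite /from_subspace ell_p_normE ltr_ofR.
apply: small => n; rewrite subE ger0_norm ?modulus_ge0//.
  rewrite (le_trans (modulus_le _ _))// modulusN.
  rewrite (le_trans _ (ler_norm _))// mulr_natl mulr2n.
  by rewrite lerD ?ua ?va.
by move=> nN; exact/ltW/(uv (Ordinal nN)).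
Qed.

Lemma compact_ell_p_box : compact ell_p_box.
Proof.
have -> : ell_p_box = to_ell_p @` seq_box.
  apply/seteqP; split => [u ua|_ [u ua <-] n]; last by rewrite to_ell_pE.
  by exists (u : nat -> K^o) => //; apply: val_inj; exact: to_ell_pE.
exact: continuous_compact to_ell_p_continuous compact_seq_box.
Qed.

End ell_p_topology.

Theorem proposition1p1 (R : realType) (s : scalar_kind) (p : R) (p1 : 1 <= p)
    (X : completeNormedModType (scalars R s)) (A : set X)
    (hA : p_limited p A)
    (T : {linear X -> ell_p s p1})
    (hT : exists M : R, forall x : X, `|T x| <= ofR s M * `|x|) :
  compact (closure (T @` A)).
Proof.
have Tlin n : linear (fun x => (T x : ell_p s p1) n).
  by move=> c x y; rewrite linearP.
pose f n : {linear X -> (scalars R s)^o} :=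
  HB.pack (fun x => (T x : ell_p s p1) n)
    (GRing.isLinear.Build _ _ _ _ _ (Tlin n)).
have [M TM] := hT.
have fcont n : continuous (f n).
  apply: bounded_linear_continuous; apply/linear_boundedP.
  near=> r => x; apply: le_trans (ell_p_coord_le_norm (T x) n) _.
  apply: le_trans (TM x) _; rewrite ler_wpM2r//.
  by near: r; apply: nbhs_pinfty_ge; exact: ofR_real.
have fsum : weak_star_p_summable p f.
  move=> x; have := ell_p_summable (T x); rewrite /p_summable.
  under eq_eseriesr do rewrite ger0_norm ?modulus_ge0//.
  exact.
have [a ap fa] := hA f fcont fsum.
have boxc := @compact_ell_p_box R s p p1 a ap.
apply: (subclosed_compact _ boxc); first exact: closed_closure.
(* Being compact in a Hausdorff space, the box contains the closure. *)
rewrite [X in _ `<=` X](closure_id _).1; last first.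
  by apply: compact_closed => //; exact: norm_hausdorff.
by apply: closure_subset => _ [x Ax <-] n; exact/ltW/fa.
Unshelve. all: by end_near. Qed.
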